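(* Let $(M,d)$ be a bounded metric space with Borel $\sigma$-algebra $\mathcal{B}$, let $f:M\to M$ be a measurable map, and let $\mu$ be an $f$-invariant Borel probability measure on $(M,\mathcal{B})$. If the system $(M,\mathcal{B},\mu,f)$ is weakly mixing, then it exhibits global SDIC, i.e. for every nonempty open set $B\subseteq \mathrm{supp}(\mu)$, $$\sup\{\mathrm{dia}(f^n(B)) \mid n\ge 0\} = \mathrm{dia}(\mathrm{supp}(\mu)).$$
   Context: $f^n$ denotes the $n$-th iterate of $f$ ($f^0=\mathrm{id}$). Diameter: $\mathrm{dia}(B)=\sup\{d(x,y)\mid x,y\in B\}$. Support: $\mathrm{supp}(\mu)=\{x\in M \mid \mu(N_x)>0 \text{ for every open neighborhood } N_x \text{ of } x\}$. Weakly mixing: for all $A_1,A_2\in\mathcal{B}$, $$\lim_{N\to\infty}\frac{1}{N+1}\sum_{n=0}^N\left|\mu\left(A_1\cap f^{-n}(A_2)\right)-\mu(A_1)\mu(A_2)\right|=0.$$ Global SDIC (sensitive dependence on initial conditions): every nonempty open set $B\subseteq\mathrm{supp}(\mu)$ satisfies $\sup\{\mathrm{dia}(f^n(B))\mid n\ge0\}=\mathrm{dia}(\mathrm{supp}(\mu))$.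
   Formalization: For merely measurable f equality can fail (a null point of supp(μ) may be sent far outside it), so only sup ≥ dia(supp(μ)) is stated in general; equality is stated under the added assumption f(supp(μ)) ⊆ supp(μ), automatic for continuous f. *)

(* Defs.v *)
(* MathComp-Analysis *)
From HB Require Import structures.
From mathcomp Require Import all_boot all_order all_algebra.
From mathcomp Require Import all_classical all_reals all_analysis.

Set Implicit Arguments.
Unset Strict Implicit.
Unset Printing Implicit Defensive.

Import Order.TTheory GRing.Theory Num.Theory.
Import numFieldNormedType.Exports.

Local Open Scope classical_set_scope.
Local Open Scope ring_scope.

(* measurableType requires a distinguished point. This is harmless here: a
   space carrying a probability measure is nonempty. *)
#[short(type="pmetricType")]
HB.structure Definition PointedMetric (K : numDomainType) :=
  {M of Metric K M & isPointed M}.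

Notation borel M := (g_sigma_algebraType (@open M)).

Definition bounded_space (R : realType) (M : metricType R) : Prop :=
  exists K : R, forall x y : M, mdist x y <= K.

(* sup is the real supremum, with junk value 0 on unbounded sets; dia is only
   meaningful when M is bounded. *)
Definition dia (R : realType) (M : metricType R) (B : set M) : R :=
  sup [set mdist x y | x in B & y in B].

Definition msupport (R : realType) (M : topologicalType) (mu : set M -> \bar R)
    : set M :=
  [set x | forall U : set M, open_nbhs x U -> (0 < mu U)%E].

Section dynamics.
Context (d : measure_display) (T : measurableType d) (R : realType).
Implicit Types (mu : probability T R) (f : T -> T).

Definition measure_invariant mu f : Prop :=
  forall A : set T, measurable A -> mu (f @^-1` A) = mu A.

Definition weakly_mixing mu f : Prop :=
  forall A1 A2 : set T, measurable A1 -> measurable A2 ->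
    (fun N : nat => N.+1%:R^-1 * \sum_(0 <= n < N.+1)
       `|fine (mu (A1 `&` iter n f @^-1` A2)) - fine (mu A1) * fine (mu A2)|)
      @ \oo --> (0 : R).

End dynamics.

Definition sup_dia_iter (R : realType) (M : metricType R) (f : M -> M)
    (B : set M) : R :=
  sup [set dia (iter n f @` B) | n in [set: nat]].

Definition global_SDIC (R : realType) (M : metricType R)
    (mu : set M -> \bar R) (f : M -> M) : Prop :=
  forall B : set M, open B -> B !=set0 -> B `<=` msupport mu ->
    sup_dia_iter f B = dia (msupport mu).

(* Main.v *)
(* Weak mixing makes the Cesaro means of both |mu(B `&` f^-n U) - mu B mu U| and
   |mu(B `&` f^-n V) - mu B mu V| vanish, so for B, U, V of positive measure a
   single n makes f^n(B) meet both U and V. Taking for U and V small balls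
   around two points of the support, f^n(B) has diameter at least their distance
   up to an arbitrarily small error. *)
Require Import Defs.
From mathcomp Require Import all_boot all_order all_algebra.
From mathcomp Require Import all_classical all_reals all_analysis.
From mathcomp Require Import lra.

Import Order.TTheory GRing.Theory Num.Theory.
Import numFieldNormedType.Exports.

Local Open Scope classical_set_scope.
Local Open Scope ring_scope.

Section diameter.
Context {R : realType} {M : metricType R} (hM : bounded_space M).
Implicit Types B C : set M.

Lemma bounded_space_dist_ubound B :
  has_ubound [set mdist x y | x in B & y in B].
Proof. by have [K hK] := hM; exists K => _ [x _ [y _ <-]]. Qed.

Lemma le_mdist_dia B x y : B x -> B y -> mdist x y <= dia B.
Proof.
move=> Bx By; apply: ub_le_sup; first exact: bounded_space_dist_ubound.
by exists x => //; exists y.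
Qed.

Lemma dia_le B K : B !=set0 ->
  (forall x y, B x -> B y -> mdist x y <= K) -> dia B <= K.
Proof.
move=> [x Bx] hK; apply: ge_sup; first by exists (mdist x x), x => //; exists x.
by move=> _ [y By [z Bz <-]]; exact: hK.
Qed.

Lemma le_dia B C : B !=set0 -> B `<=` C -> dia B <= dia C.
Proof.
by move=> B0 BC; apply: dia_le => // x y /BC Cx /BC Cy; exact: le_mdist_dia.
Qed.

(** The bound on distances also bounds all the diameters, so the supremum over [n] is a true one and
    not the default 0. *)
Lemma dia_iter_le_sup (f : M -> M) B n : B !=set0 ->
  dia (iter n f @` B) <= sup_dia_iter f B.
Proof.
move=> [b Bb]; apply: ub_le_sup; last by exists n.
have [K hK] := hM; exists K => _ [m _ <-].
by apply: dia_le => [|x y _ _ //]; exists (iter m f b), b.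
Qed.

End diameter.

(** If every [n] missed [U] or [V], the two deviations from independence would always add up to at
    least a fixed [c > 0], while weak mixing sends the mean of their sum to 0. *)
Lemma weakly_mixing_common_time {d : measure_display} {T : measurableType d}
    {R : realType} (mu : probability T R) (f : T -> T) (B U V : set T) :
  weakly_mixing mu f -> measurable B -> measurable U -> measurable V ->
  (0 < mu B)%E -> (0 < mu U)%E -> (0 < mu V)%E ->
  exists n, (B `&` iter n f @^-1` U !=set0) /\ (B `&` iter n f @^-1` V !=set0).
Proof.
move=> mix mB mU mV B0 U0 V0.
have fine_mu_gt0 A : measurable A -> (0 < mu A)%E -> 0 < fine (mu A).
  by move=> mA A0; rewrite fine_gt0// A0/= ltey_eq fin_num_measure.
have [//|meet_fails] := pselect (exists n,
  (B `&` iter n f @^-1` U !=set0) /\ (B `&` iter n f @^-1` V !=set0)).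
exfalso.
pose dev W n : R :=
  `|fine (mu (B `&` iter n f @^-1` W)) - fine (mu B) * fine (mu W)|.
(* A missed set [W] deviates by exactly [mu B * mu W]; the minimum covers both cases. *)
pose c := Num.min (fine (mu B) * fine (mu U)) (fine (mu B) * fine (mu V)).
have c0 : 0 < c by rewrite lt_min !mulr_gt0 ?fine_mu_gt0.
have dev_disjoint W n : measurable W -> ~ (B `&` iter n f @^-1` W !=set0) ->
    dev W n = fine (mu B) * fine (mu W).
  move=> mW /set0P/negP/negPn/eqP E; rewrite /dev E measure0 sub0r normrN ger0_norm//.
  by rewrite mulr_ge0// fine_ge0.
have c_le_dev n : c <= dev U n + dev V n.
  have [BU|nBU] := pselect (B `&` iter n f @^-1` U !=set0).
    have [BV|nBV] := pselect (B `&` iter n f @^-1` V !=set0).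
      by exfalso; apply: meet_fails; exists n.
    by rewrite (dev_disjoint V)// ler_wpDl ?normr_ge0// /c ge_min lexx orbT.
  by rewrite (dev_disjoint U)// ler_wpDr ?normr_ge0// /c ge_min lexx.
have := cvgD (mix _ _ mB mU) (mix _ _ mB mV); rewrite addr0.
(* A single [N] suffices: the mean there is below [c], yet it averages [N.+1] terms that are each at
   least [c]. *)
move/(_ _)/cvgr0_norm_lt => /(_ _ c0) [N _ /(_ N (leqnn N))] /=.
apply/negP; rewrite -leNgt fctE -mulrDr -big_split/=.
apply: le_trans (ler_norm _).
rewrite -ler_pdivrMl ?invr_gt0// invrK.
rewrite [leLHS](_ : _ = \sum_(0 <= n < N.+1) c); first by apply: ler_sum => n _; exact: c_le_dev.
by rewrite sumr_const_nat subn0 mulr_natl.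
Qed.

Lemma borel_open_measurable {M : ptopologicalType} (A : set M) :
  open A -> measurable (A : set (borel M)).
Proof. exact: sub_sigma_algebra. Qed.

(* Without forward invariance of the support, a point of B lying in a null set
   may leave the support, and only the inequality >= holds. *)
Theorem proposition1 (R : realType) (M : pmetricType R)
    (hM : bounded_space M)
    (f : M -> M) (hf : measurable_fun [set: borel M] (f : borel M -> borel M))
    (mu : probability (borel M) R) (hinv : measure_invariant mu f)
    (hwm : weakly_mixing mu f) :
  (forall B : set M, open B -> B !=set0 -> B `<=` msupport mu ->
     dia (msupport mu) <= sup_dia_iter f B)
  /\ (f @` msupport mu `<=` msupport mu -> global_SDIC mu f).
Proof.
have dia_supp_le B : open B -> B !=set0 -> B `<=` msupport mu ->
    dia (msupport mu) <= sup_dia_iter f B.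
  move=> oB [b Bb] Bsupp; apply: dia_le; first by exists b; exact: Bsupp.
  move=> x y suppx suppy; apply/ler_addgt0Pr => e e0.
  (* Replacing [x] and [y] by points of balls around them costs at most [e / 2] each. *)
  have e20 : 0 < e / 2 by rewrite divr_gt0.
  have ballx := @open_nbhs_ball R M x (PosNum e20).
  have bally := @open_nbhs_ball R M y (PosNum e20).
  (* The interiors of the balls are open neighborhoods of support points, hence of positive measure;
     so is [B], as a neighborhood of [b]. *)
  have [n [[p [Bp /interior_subset/= xp]] [q [Bq /interior_subset/= yq]]]] :=
    weakly_mixing_common_time _ _ _ _ _ hwm (borel_open_measurable _ oB)
      (borel_open_measurable _ ballx.1) (borel_open_measurable _ bally.1)
      (Bsupp _ Bb _ (conj oB Bb)) (suppx _ ballx) (suppy _ bally).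
  rewrite ballEmdist/= in xp; rewrite ballEmdist/= in yq.
  have pq : mdist (iter n f p) (iter n f q) <= sup_dia_iter f B.
    apply: le_trans (dia_iter_le_sup hM f B n _); last by exists b.
    by apply: le_mdist_dia => //; [exists p|exists q].
  have xq := metric_triangle x (iter n f p) y.
  have py := metric_triangle (iter n f p) (iter n f q) y.
  rewrite (metric_sym (iter n f q)) in py.
  lra.
(* For the reverse inequality, forward invariance keeps every iterated image of [B] inside the
   support. *)
split=> // fsupp B oB B0 Bsupp; apply/eqP; rewrite eq_le dia_supp_le// andbT.
apply: ge_sup; first by exists (dia (iter 0 f @` B)), 0%N.
move=> _ [n _ <-]; apply: le_dia => //.
  by have [b Bb] := B0; exists (iter n f b), b.
move=> _ [b /Bsupp suppb <-]; elim: n => //= n IHn.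
by apply: fsupp; exists (iter n f b).
Qed.
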